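(* Let $\mathcal{O}$ be an optimality operator, let $\{\mathcal{C}_i\}_{i\in I}$ be a realizable exclusivity partition of an ambient family $\mathcal{M}$ of losses under $\mathcal{O}$, and let $L\in\mathcal{C}_i$, $L'\in\mathcal{C}_j$ with $i\ne j$. Then $\mathcal{O}(L)\cap\mathcal{O}(L')=\emptyset$: no estimator is $\mathcal{O}$-optimal for both $L$ and $L'$. Consequently: (a) in the quantile setting described in the context, for $\tau\neq\tau'$ in $(0,1)$, $L\in\mathcal{L}_\tau$ and $L'\in\mathcal{L}_{\tau'}$, no decision rule is Bayes-optimal for both $L$ and $L'$; (b) in the margin setting described in the context, for regular margin losses $L_\phi,L_{\phi'}$ with distinct margin invariants $H_\phi\ne H_{\phi'}$, no score rule is Bayes-optimal for both $L_\phi$ and $L_{\phi'}$; (c) in the Huber setting described in the context, for $\kappa\ne\kappa'$ in $(0,\infty)$, no equivariant rule is optimal for both $L_\kappa$ and $L_{\kappa'}$.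
   Context: General notions. $\mathscr{D}$ is the class of estimators (decision rules); an optimality operator $\mathcal{O}$ assigns to each loss $L$ a subset $\mathcal{O}(L)\subseteq\mathscr{D}$. $\mathcal{C}\subseteq\mathcal{M}$ is an exclusivity region within $\mathcal{M}$ if no $\delta\in\mathscr{D}$ belongs to $\mathcal{O}(L)$ for some $L\in\mathcal{C}$ and also to $\mathcal{O}(L')$ for some $L'\in\mathcal{M}\setminus\mathcal{C}$. A family $\{\mathcal{C}_i\}_{i\in I}$ of subsets of $\mathcal{M}$ is an exclusivity partition of $\mathcal{M}$ if the $\mathcal{C}_i$ are pairwise disjoint and each is an exclusivity region within $\mathcal{M}$; it is realizable if each $\mathcal{C}_i$ contains a loss $L$ with $\mathcal{O}(L)\ne\emptyset$. Quantile setting. $\Theta\subseteq\mathbb{R}$ nonempty closed, action space $\mathcal{A}=\mathbb{R}$, a dominated model $\{P_\theta\}$ for $X$, a prior on $\Theta$, $P_X$ the marginal law of $X$, $\mathscr{D}$ a class of measurable rules $\mathcal{X}\to\mathbb{R}$; $\delta\in\mathscr{D}$ is Bayes-optimal for $L$ iff $\delta(x)$ minimizes $a\mapsto\mathbb{E}[L(\theta,a)\mid X=x]$ for $P_X$-a.e. $x$. For $P_X$-a.e. $x$ the posterior of $\theta$ given $X=x$ is non-atomic, supported on an interval $S_x$, with CDF $F_{\theta\mid X=x}$ continuous on $\mathbb{R}$ and strictly increasing on $S_x$. $\mathscr{D}$ contains the measurable selectors $x\mapsto F^{-1}_{\theta\mid X=x}(\tau)$ for all $\tau\in(0,1)$.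 $\mathscr{L}_{\mathrm{asym}}$ is the class of losses $L:\Theta\times\mathbb{R}\to[0,\infty)$ (measurable, continuous in $a$), convex in $a$, for which there are a Borel, locally bounded $s_L:\mathbb{R}\to(0,\infty)$ and a unique $\tau(L)\in(0,1)$ with $\partial_aL(\theta,a)=s_L(a)(\mathbf{1}\{\theta<a\}-\tau(L))$ classically for $a\ne\theta$, and with subdifferential $[-s_L(\theta)\tau(L),s_L(\theta)(1-\tau(L))]$ at $a=\theta$. Every $L\in\mathscr{L}_{\mathrm{asym}}$ has $\mathbb{E}[L(\theta,a)\mid X=x]<\infty$ for $P_X$-a.e. $x$ and every $a$. $\mathcal{L}_\tau=\{L\in\mathscr{L}_{\mathrm{asym}}:\tau(L)=\tau\}$. Margin setting. $(X,Y)$ with $Y\in\{-1,+1\}$, $\eta(x)=\mathbb{P}(Y=+1\mid X=x)$, $\eta(X)\in(0,1)$ $P_X$-a.s. and $P_X(\eta(X)\in U)>0$ for every nonempty open interval $U\subseteq(0,1)$. A margin loss $L_\phi(y,t)=\phi(yt)$ is regular if $\phi:\mathbb{R}\to[0,\infty)$ is convex, $C^1$, strictly decreasing, and the margin invariant $H_\phi(t)=\phi'(-t)/\phi'(t)$ is well-defined, continuous, strictly increasing and onto $(0,\infty)$. A measurable score rule $f:\mathcal{X}\to\mathbb{R}$ is Bayes-optimal for $L_\phi$ iff $f(x)$ minimizes $\alpha\mapsto\eta(x)\phi(\alpha)+(1-\eta(x))\phi(-\alpha)$ over $\mathbb{R}$ for $P_X$-a.e. $x$. Huber setting. $L_\kappa(\theta,a)=\frac12(a-\theta)^2$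 if $|a-\theta|\le\kappa$ and $\kappa|a-\theta|-\frac12\kappa^2$ otherwise; $\psi_\kappa(u)=u$ for $|u|\le\kappa$, $\kappa\,\mathrm{sign}(u)$ for $|u|>\kappa$. $X=\theta+Z$ with $Z$ having a continuous strictly positive density on $\mathbb{R}$ and $\mathbb{E}|Z|<\infty$; $b_\kappa$ is the unique root of $\mathbb{E}[\psi_\kappa(Z-b)]=0$; $Z$ is strictly skewed: there is $\sigma\in\{+1,-1\}$ with $\sigma\,(P(Z-b_\kappa>\kappa)-P(Z-b_\kappa<-\kappa))>0$ for every $\kappa>0$. Equivariant rules are $\delta_b(x)=x-b$, $b\in\mathbb{R}$, and $\delta_b$ is optimal for $L_\kappa$ iff $b$ minimizes over $\mathbb{R}$ the ($\theta$-independent) risk $\mathbb{E}_\theta[L_\kappa(\theta,\delta_b(X))]$. *)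

(* Defs.v *)
(* MathComp-Analysis *)
From HB Require Import structures.
From mathcomp Require Import all_boot all_order all_algebra.
From mathcomp Require Import all_classical all_reals all_analysis.
From mathcomp Require Import measurable_realfun.

Set Implicit Arguments.
Unset Strict Implicit.
Unset Printing Implicit Defensive.
Import Order.TTheory GRing.Theory Num.Theory.
Import numFieldNormedType.Exports.
Local Open Scope classical_set_scope.
Local Open Scope ring_scope.

Section Exclusivity.
Variables (T Loss : Type) (D : set T) (O : Loss -> set T).

Definition optimality_operator : Prop := forall L, O L `<=` D.

Definition exclusivity_region (M C : set Loss) : Prop :=
  C `<=` M /\
  ~ exists delta, [/\ D delta, (exists2 L, C L & O L delta)
                    & (exists2 L', (M `\` C) L' & O L' delta)].

(* The cells are not required to cover [M]. *)
Definition exclusivity_partition (I : Type) (M : set Loss)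
    (C : I -> set Loss) : Prop :=
  trivIset setT C /\ forall i, exclusivity_region M (C i).

Definition realizable (I : Type) (C : I -> set Loss) : Prop :=
  forall i, exists2 L, C i L & O L !=set0.
End Exclusivity.

Section AsymmetricLosses.
Variable R : realType.

Definition subdifferential (f : R -> R) (a : R) : set R :=
  [set g | forall b, f a + g * (b - a) <= f b].

(* A loss on [Theta * R] is represented by a function on [R * R] whose values
   outside [Theta * R] are irrelevant. *)
Definition asym_slope (Theta : set R) (s : R -> R) (tau : R)
    (L : R -> R -> R) : Prop :=
  forall t, Theta t ->
    (forall a, a != t -> is_derive a 1 (L t) (s a * ((t < a)%R%:R - tau))) /\
    subdifferential (L t) t = `[- (s t * tau), s t * (1 - tau)]%classic.

Definition asym_level (Theta : set R) (L : R -> R -> R) (tau : R) : Prop :=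
  0 < tau < 1 /\
  exists s : R -> R,
    [/\ measurable_fun setT s,
        [locally [bounded s a | a in setT]],
        forall a, 0 < s a
      & asym_slope Theta s tau L].

Definition asym_loss (Theta : set R) (L : R -> R -> R) : Prop :=
  [/\ measurable_fun (Theta `*` setT) (fun p : R * R => L p.1 p.2),
      forall t, Theta t -> forall a, 0 <= L t a,
      forall t, Theta t -> continuous (L t),
      forall t, Theta t -> convex_function setT (L t : R^o -> R^o)
    & exists! tau, asym_level Theta L tau].

End AsymmetricLosses.

Definition quantile (R : realType) (F : R -> R) (tau : R) : R :=
  inf [set t | tau <= F t].

(* [model t] is the law of the observation given the parameter [t]; its values
   for [t] outside [Theta] are irrelevant.  [posterior] is a regular
   conditional law of the parameter given the observation. *)
Record quantile_setting (R : realType) (d : measure_display)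
    (X : measurableType d) := QuantileSetting {
  Theta : set R;
  Theta_nonempty : Theta !=set0;
  Theta_closed : closed Theta;
  model : R -> probability X R;
  model_measurable : forall A, measurable A ->
    measurable_fun Theta (fun t => model t A);
  model_dominated : exists mu : {sigma_finite_measure set X -> \bar R},
    forall t, Theta t -> model t `<< mu;
  prior : probability R R;
  prior_Theta : prior Theta = 1%E;
  marginal : probability X R;
  marginalE : forall A, measurable A ->
    marginal A = (\int[prior]_(t in Theta) model t A)%E;
  posterior : R.-pker X ~> R;
  posteriorE : forall (A : set X) (B : set R), measurable A -> measurable B ->
    (\int[prior]_(t in Theta `&` B) model t A)%E =
    (\int[marginal]_(x in A) posterior x B)%E;
  posterior_cdf (x : X) (t : R) : R := fine (posterior x `]-oo, t]%classic);
  posterior_nonatomic : {ae marginal, forall x, forall t : R,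
    posterior x [set t] = 0%E};
  posterior_regular : {ae marginal, forall x, exists S : set R,
    [/\ is_interval S, posterior x S = 1%E, continuous (posterior_cdf x)
      & forall t u, S t -> S u -> t < u ->
          posterior_cdf x t < posterior_cdf x u]};
  rules : set (X -> R);
  rules_measurable : forall delta, rules delta -> measurable_fun setT delta;
  (* The posterior, hence its quantile, is determined only up to a
     [marginal]-null set. *)
  rules_quantile : forall tau, 0 < tau < 1 ->
    exists2 delta, rules delta &
      {ae marginal, forall x, delta x = quantile (posterior_cdf x) tau}
}.

Section QuantileClasses.
Variables (R : realType) (d : measure_display) (X : measurableType d).
Variable Q : quantile_setting R X.

Definition posterior_risk (L : R -> R -> R) (x : X) (a : R) : \bar R :=
  (\int[posterior Q x]_(t in Theta Q) (L t a)%:E)%E.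

(* Finiteness of the posterior risk is a condition for membership: [asym_loss]
   is preserved by the addition of any nonnegative measurable function of the
   parameter, so finiteness cannot hold for all such losses at once. *)
Definition asym_class : set (R -> R -> R) :=
  [set L | asym_loss (Theta Q) L /\
           {ae marginal Q, forall x, forall a, (posterior_risk L x a < +oo)%E}].

Definition asym_level_class (tau : R) : set (R -> R -> R) :=
  [set L | asym_class L /\ asym_level (Theta Q) L tau].

Definition bayes_optimal (L : R -> R -> R) : set (X -> R) :=
  [set delta | rules Q delta /\
    {ae marginal Q, forall x, forall a,
      (posterior_risk L x (delta x) <= posterior_risk L x a)%E}].
End QuantileClasses.

(* [eta] is a version of the conditional probability of [Y = 1] given [X]. *)
Record margin_setting (R : realType) (d d' : measure_display)
    (Omega : measurableType d) (T : measurableType d') := MarginSetting {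
  margin_pr : probability Omega R;
  margin_X : {RV margin_pr >-> T};
  margin_Y : {RV margin_pr >-> R};
  margin_YE : forall w, margin_Y w = -1 \/ margin_Y w = 1;
  eta : T -> R;
  eta_measurable : measurable_fun setT eta;
  etaE : forall A, measurable A ->
    margin_pr ((margin_X @^-1` A) `&` (margin_Y @^-1` [set 1])) =
    (\int[distribution margin_pr margin_X]_(x in A) (eta x)%:E)%E;
  eta_01 : {ae distribution margin_pr margin_X, forall x, 0 < eta x < 1};
  eta_full_support : forall a b : R, 0 <= a -> a < b -> b <= 1 ->
    (0 < distribution margin_pr margin_X (eta @^-1` `]a, b[))%E
}.

Section MarginLosses.
Variable R : realType.

Definition margin_loss (phi : R -> R) (y t : R) : R := phi (y * t).

Definition margin_invariant (phi : R -> R) (t : R) : R :=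
  derive1 phi (- t) / derive1 phi t.

(* [H_phi] is well defined when [derive1 phi] does not vanish. *)
Definition regular_margin (phi : R -> R) : Prop :=
  [/\ forall t, 0 <= phi t,
      convex_function setT (phi : R^o -> R^o),
      (forall t, derivable phi t 1) /\ continuous (derive1 phi),
      {homo phi : t u / t < u >-> u < t}
    & [/\ forall t, derive1 phi t != 0,
          continuous (margin_invariant phi),
          {homo margin_invariant phi : t u / t < u}
        & range (margin_invariant phi) = `]0, +oo[%classic]].

Definition margin_bayes_optimal (d d' : measure_display)
    (Omega : measurableType d) (T : measurableType d')
    (S : margin_setting R Omega T) (L : R -> R -> R) : set (T -> R) :=
  [set f | measurable_fun setT f /\
    {ae distribution (margin_pr S) (margin_X S), forall x, forall alpha,
      eta S x * L 1 (f x) + (1 - eta S x) * L (-1) (f x) <=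
      eta S x * L 1 alpha + (1 - eta S x) * L (-1) alpha}].
End MarginLosses.

Section HuberLosses.
Variable R : realType.

Definition huber_loss (kappa theta a : R) : R :=
  if `|a - theta| <= kappa then (a - theta) ^+ 2 / 2
  else kappa * `|a - theta| - kappa ^+ 2 / 2.

Definition huber_psi (kappa u : R) : R :=
  if `|u| <= kappa then u else kappa * Num.sg u.

Definition equivariant_rule (b : R) : R -> R := fun x => x - b.
End HuberLosses.

Record huber_setting (R : realType) (d : measure_display)
    (Omega : measurableType d) := HuberSetting {
  huber_pr : probability Omega R;
  huber_Z : {RV huber_pr >-> R};
  huber_density : R -> R;
  huber_density_continuous : continuous huber_density;
  huber_density_gt0 : forall z, 0 < huber_density z;
  huber_densityE : forall A, measurable A ->
    distribution huber_pr huber_Z A =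
    (\int[lebesgue_measure]_(z in A) (huber_density z)%:E)%E;
  huber_Z_integrable : ('E_huber_pr[(fun w => `|huber_Z w|)%R] < +oo)%E;
  huber_b : R -> R;
  huber_bP : forall kappa, 0 < kappa -> forall b : R,
    ('E_huber_pr[(fun w => huber_psi kappa (huber_Z w - b))%R] = 0)%E <->
    b = huber_b kappa;
  huber_skewed : exists sigma : R, (sigma = 1 \/ sigma = -1) /\
    forall kappa, 0 < kappa ->
      0 < sigma *
        (fine (huber_pr [set w | huber_Z w - huber_b kappa > kappa]) -
         fine (huber_pr [set w | huber_Z w - huber_b kappa < - kappa]))
}.

Section HuberOptimality.
Variables (R : realType) (d : measure_display) (Omega : measurableType d).
Variable S : huber_setting R Omega.

(* Under the parameter [theta] the observation is [theta + Z]. *)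
Definition equivariant_risk (L : R -> R -> R) (theta b : R) : \bar R :=
  ('E_(huber_pr S)[
    (fun w => L theta (equivariant_rule b (theta + huber_Z S w)))%R])%E.

Definition equivariant_optimal (L : R -> R -> R) : set (R -> R) :=
  [set delta | exists2 b, delta = equivariant_rule b &
    forall theta b', (equivariant_risk L theta b <= equivariant_risk L theta b')%E].
End HuberOptimality.

(* Main.v *)
(* A rule optimal for two losses satisfies the first-order conditions of both.
   Quantile losses: these read F(delta(x)) = tau = tau', where F is the posterior
   cdf.  Margin losses: they read H_phi(f(x)) = eta(x) / (1 - eta(x)) =
   H_phi'(f(x)); if H_phi(t) < H_phi'(t), then whenever the odds lie strictly
   in between, the first equation forces f(x) > t and the second f(x) < t.
   Huber losses: they make b a common root b_kappa = b_kappa'.  For this b, the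
   function G(k) = E[psi_k(Z - b)] has derivative P(Z - b > k) - P(Z - b < -k),
   which by skewness has the same nonzero sign at every zero of G (a zero of G
   being a k with b_k = b); so all zeros of the continuous function G are crossed
   in the same direction, and there is at most one. *)
Require Import Defs.
From mathcomp Require Import all_boot all_order all_algebra.
From mathcomp Require Import all_classical all_reals all_analysis.
From mathcomp Require Import measurable_realfun.
From mathcomp Require Import ring lra.
Import Order.TTheory GRing.Theory Num.Theory.
Import numFieldNormedType.Exports.
Local Open Scope classical_set_scope.
Local Open Scope ring_scope.

Set Implicit Arguments.
Unset Strict Implicit.
Unset Printing Implicit Defensive.

(** * Abstract exclusivity, and supporting lines of convex functions *)

Lemma optimal_disjoint (T Loss I : Type) (D : set T) (O : Loss -> set T)
    (M : set Loss) (C : I -> set Loss) (i j : I) (L L' : Loss) :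
  optimality_operator D O -> exclusivity_partition D O M C ->
  i <> j -> C i L -> C j L' -> O L `&` O L' = set0.
Proof.
move=> OD [trivC exclC] ij CL CL'.
(* A common optimal rule contradicts the exclusivity of [C i]: since [C j] lies in [M] and is
   disjoint from [C i], the loss [L'] is in [M] outside [C i]. *)
rewrite -subset0 => delta [OL OL'].
have [_ []] := exclC i.
exists delta; split; [exact: OD OL|by exists L|exists L' => //].
split; first exact: (exclC j).1.
move=> CiL'; apply: ij.
by apply: (trivC i j) => //; exists L'.
Qed.

(** Convexity bounds the difference quotient of [f] from [a] in the direction [b - a], at every step
    [l] in (0, 1), by [f b - f a]; its limit as [l] decreases to 0 is [D * (b - a)]. *)
Lemma convex_ge_tangent (R : realType) (f : R -> R) (a b D : R) :
  convex_function setT (f : R^o -> R^o) -> is_derive a 1 f D ->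
  f a + D * (b - a) <= f b.
Proof.
move=> cf dfa.
have df : differentiable f a by apply/derivable1_diffP; exact: ex_derive.
have dE : 'D_(b - a) f a = D * (b - a).
  by rewrite deriveE// diff1E// derive1E derive_val /= mulrC.
rewrite -lerBrDl -dE.
have : derivable f a (b - a) by exact: diff_derivable.
move/cvg_dnbhs_at_right => fc.
apply: (cvgr_to_le (F := 0^'+) fc).
near=> l.
have l0 : 0 < l by [].
have l1 : l < 1 by [].
rewrite /= [_ *: _]/GRing.scale/= mulrC ler_pdivrMr//.
have : f (l * b + (1 - l) * a) <= l * f b + (1 - l) * f a.
  exact: (cf (Itv01 (ltW l0) (ltW l1)) b a (in_setT _) (in_setT _)).
have -> : l * b + (1 - l) * a = l * (b - a) + a by ring.
lra.
Unshelve. all: by end_near. Qed.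

(** * Quantile losses *)

(** Off the kink the slope is the derivative. At [b = t] the indicator vanishes and the slope
    [- (s t * tau)] is the left end of the prescribed subdifferential. *)
Lemma asym_loss_ge_tangent (R : realType) (Theta : set R) (s : R -> R) (tau : R)
    (L : R -> R -> R) (t a b : R) :
  (forall u, 0 < s u) -> asym_slope Theta s tau L ->
  convex_function setT (L t : R^o -> R^o) -> Theta t ->
  L t b + s b * ((t < b)%R%:R - tau) * (a - b) <= L t a.
Proof.
move=> s0 slope cvxL Tt; have [dL subL] := slope t Tt.
have [tb|bt] := eqVneq b t; last exact: convex_ge_tangent (dL b bt).
rewrite tb ltxx sub0r.
have : subdifferential (L t) t (- (s t * tau)).
  by rewrite subL /= in_itv/= lexx/=; have := s0 t; nra.
by move=> /(_ a); rewrite mulrN.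
Qed.

(* Signed terms are distributed over both sides so that every integrand is
   nonnegative. *)
Lemma integral_exchange (d : measure_display) (T : measurableType d)
    (R : realType) (mu : {measure set T -> \bar R}) (D A : set T)
    (f g : T -> R) (p q p' q' : R) :
  measurable D -> measurable A -> mu D = 1%E ->
  measurable_fun D f -> measurable_fun D g ->
  (forall t, D t -> 0 <= f t) -> (forall t, D t -> 0 <= g t) ->
  0 <= p -> 0 <= q -> 0 <= p' -> 0 <= q' ->
  (forall t, D t -> f t + p * \1_A t + q <= g t + p' * \1_A t + q') ->
  (\int[mu]_(t in D) (g t)%:E <= \int[mu]_(t in D) (f t)%:E)%E ->
  (\int[mu]_(t in D) (f t)%:E < +oo)%E ->
  p * fine (mu (A `&` D)) + q <= p' * fine (mu (A `&` D)) + q'.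
Proof.
move=> mD mA muD mf mg f0 g0 p0 q0 p'0 q'0 fg intgf intf.
have split_int (h : T -> R) (r w : R) :
    measurable_fun D h -> (forall t, D t -> 0 <= h t) -> 0 <= r -> 0 <= w ->
    (\int[mu]_(t in D) (h t + r * \1_A t + w)%:E =
     \int[mu]_(t in D) (h t)%:E + (r%:E * mu (A `&` D) + w%:E))%E.
  move=> mh h0 r0 w0.
  have mI : measurable_fun D (fun t => r * (\1_A t : R)).
    by apply: measurable_funM => //; exact: measurable_indic.
  under eq_integral do rewrite !EFinD -addeA.
  rewrite ge0_integralD//=; last 3 first.
  - exact/measurable_EFinP.
  - by move=> t _; rewrite -EFinD lee_fin addr_ge0// mulr_ge0.
  - by apply/measurable_EFinP; exact: measurable_funD.
  rewrite ge0_integralD//=; last 2 first.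
  - by move=> t _; rewrite lee_fin mulr_ge0.
  - exact/measurable_EFinP.
  rewrite [X in (_ + (_ + X))%E]integral_cst// muD mule1.
  under [X in (_ + (X + _))%E]eq_integral do rewrite EFinM.
  rewrite ge0_integralZl_EFin//; last exact/measurable_EFinP/measurable_indic.
  by rewrite integral_indic.
have : (\int[mu]_(t in D) (f t + p * \1_A t + q)%:E <=
        \int[mu]_(t in D) (g t + p' * \1_A t + q')%:E)%E.
  have mh (h : T -> R) (r w : R) : measurable_fun D h ->
      measurable_fun D (EFin \o (fun t => h t + r * \1_A t + w)).
    move=> mh; apply/measurable_EFinP; apply: measurable_funD => //.
    by apply: measurable_funD => //; apply: measurable_funM => //;
      exact: measurable_indic.
  apply: ge0_le_integral => //; try exact: mh.
  by move=> t Dt; rewrite lee_fin !addr_ge0 ?f0// mulr_ge0.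
rewrite !split_int//.
have f_fin : (\int[mu]_(t in D) (f t)%:E)%E \is a fin_num.
  rewrite ge0_fin_numE//; apply: integral_ge0 => t /f0; by rewrite lee_fin.
have g_fin : (\int[mu]_(t in D) (g t)%:E)%E \is a fin_num.
  rewrite ge0_fin_numE//; first exact: le_lt_trans intf.
  by apply: integral_ge0 => t /g0; rewrite lee_fin.
have AD_fin : mu (A `&` D) \is a fin_num.
  rewrite ge0_fin_numE//; apply: (@le_lt_trans _ _ 1%E); last exact: ltry.
  by rewrite -muD le_measure ?inE//; exact: measurableI.
move: intgf; rewrite -(fineK f_fin) -(fineK g_fin) -(fineK AD_fin).
by rewrite -!EFinM -!EFinD !lee_fin; lra.
Qed.

Section PosteriorQuantile.
Variables (R : realType) (d : measure_display) (X : measurableType d).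
Variable Q : quantile_setting R X.

Lemma measurable_Theta : measurable (Theta Q).
Proof. by apply: closed_measurable; exact: Theta_closed. Qed.

(** Disintegration over the whole observation space shows that the posterior mass of the complement
    of [Theta] has integral 0; being nonnegative, it vanishes almost everywhere. *)
Lemma posterior_Theta : {ae marginal Q, forall x, posterior Q x (~` Theta Q) = 0%E}.
Proof.
have mTC := measurableC measurable_Theta.
have := posteriorE Q measurableT mTC.
rewrite setICr integral_set0 => /esym int0.
have [+ _] := ae_eq_integral_abs (marginal Q) measurableT
  (measurable_kernel (posterior Q) _ mTC).
under eq_integral do rewrite gee0_abs//.
by move=> /(_ int0); apply: filterS => x; exact.
Qed.

Lemma measurable_loss_section (L : R -> R -> R) (a : R) :
  asym_loss (Theta Q) L -> measurable_fun (Theta Q) (L ^~ a).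
Proof.
move=> [mL _ _ _ _].
apply: (measurable_comp (F := Theta Q `*` setT) (g := pair^~ a) _ _ mL).
- exact: measurableX measurable_Theta measurableT.
- by move=> _ [t Tt <-].
- by apply: measurable_funS (pair2_measurable a).
Qed.

(* Integrate the tangent inequality at [b] over the posterior of the parameter:
   if [a] is no worse than [b], the slope [s b * (F b - tau)] is nonpositive in
   the direction from [b] to [a]. *)
Lemma posterior_cdf_minimizer (L : R -> R -> R) (tau : R) (x : X) (a b : R) :
  asym_loss (Theta Q) L -> asym_level (Theta Q) L tau ->
  posterior Q x (~` Theta Q) = 0%E -> posterior Q x [set b] = 0%E ->
  (posterior_risk Q L x b < +oo)%E ->
  (posterior_risk Q L x a <= posterior_risk Q L x b)%E ->
  (b < a -> posterior_cdf Q x b <= tau) /\ (a < b -> tau <= posterior_cdf Q x b).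
Proof.
move=> aL [/andP[tau0 tau1] [s [_ _ s0 slope]]] PT0 Pb0 bfin ab.
have [_ L0 _ cvxL _] := aL.
have tangent t : Theta Q t ->
    L t b + s b * (\1_(`]-oo, b[%classic : set R) t - tau) * (a - b) <= L t a.
  move=> Tt; rewrite indicE mem_setE in_itv/=.
  exact: asym_loss_ge_tangent (cvxL _ Tt) Tt.
have PT : posterior Q x (Theta Q) = 1%E.
  have := @prob_kernel _ _ _ _ _ (posterior Q) x.
  rewrite -(setUv (Theta Q)) measureU//.
  - by move=> <-; rewrite -[LHS]adde0; congr (_ + _)%E; rewrite -PT0.
  - exact: measurable_Theta.
  - by apply: measurableC; exact: measurable_Theta.
  - exact: setICr.
(* The tangent slope involves the strict event [t < b]. Passing to it costs only the atomless point
   [b] and the null complement of [Theta]. *)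
have -> : posterior_cdf Q x b = fine (posterior Q x (`]-oo, b[%classic `&` Theta Q)).
  rewrite /posterior_cdf; congr fine.
  rewrite -(setUitv1 true)//.
  have mI : measurable (`]-oo, b[%classic : set R) by exact: measurable_itv.
  rewrite measureU//; last first.
    by rewrite -subset0 => t /= [tb tE]; move: tb; rewrite tE in_itv/= ltxx.
  transitivity (posterior Q x `]-oo, b[%classic + 0)%E; first by congr (_ + _)%E.
  rewrite adde0 (measureDI (posterior Q x) mI measurable_Theta).
  rewrite [X in (X + _)%E](_ : _ = 0%E) ?add0e//.
  apply: (subset_measure0 _ _ _ PT0).
  - by apply: measurableD => //; exact: measurable_Theta.
  - by apply: measurableC; exact: measurable_Theta.
  - by move=> t [].
set A := `]-oo, b[%classic in tangent *.
have mA : measurable A by exact: measurable_itv.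
have mL := measurable_loss_section _ aL.
split=> [ba|ab'].
(* The tangent inequality reads [L t b + c * \1_A t <= L t a + c * tau]; integrated, it gives
   [c * F b <= c * tau], where [F] is the posterior cdf. The other case is its mirror image. *)
- pose c := s b * (a - b).
  have c0 : 0 < c by rewrite mulr_gt0// subr_gt0.
  have : c * fine (posterior Q x (A `&` Theta Q)) + 0 <=
         0 * fine (posterior Q x (A `&` Theta Q)) + c * tau.
    apply: (integral_exchange measurable_Theta mA PT (mL b) (mL a)) => //.
    + by move=> t /L0.
    + by move=> t /L0.
    + exact: ltW.
    + by rewrite mulr_ge0// ltW.
    + by move=> t /tangent; rewrite /c; lra.
  by rewrite addr0 mul0r add0r ler_pM2l.
- pose c := s b * (b - a).
  have c0 : 0 < c by rewrite mulr_gt0// subr_gt0.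
  have : 0 * fine (posterior Q x (A `&` Theta Q)) + c * tau <=
         c * fine (posterior Q x (A `&` Theta Q)) + 0.
    apply: (integral_exchange measurable_Theta mA PT (mL b) (mL a)) => //.
    + by move=> t /L0.
    + by move=> t /L0.
    + by rewrite mulr_ge0// ltW.
    + exact: ltW.
    + by move=> t /tangent; rewrite /c; lra.
  by rewrite addr0 mul0r add0r ler_pM2l.
Qed.

(** Comparing [delta x] with every other action gives a cdf at most [tau] to its left and at least
    [tau] to its right; continuity of the cdf forces equality at [delta x]. *)
Lemma bayes_optimal_cdf (L : R -> R -> R) (tau : R) (delta : X -> R) :
  asym_level_class Q tau L -> bayes_optimal Q L delta ->
  {ae marginal Q, forall x, posterior_cdf Q x (delta x) = tau}.
Proof.
move=> [[aL Lfin] Ltau] [_ opt].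
have ae_cont : {ae marginal Q, forall x, continuous (posterior_cdf Q x)}.
  by apply: filterS (posterior_regular Q) => x [S []].
apply: filterS2 (filterI Lfin opt)
  (filterI (filterI posterior_Theta (posterior_nonatomic Q)) ae_cont).
move=> x [Lxfin xopt] [[PT0 Pat] cont].
have minP b := posterior_cdf_minimizer aL Ltau PT0 (Pat b) (Lxfin b) (xopt b).
apply/eqP; rewrite eq_le; apply/andP; split.
- have cl := cvg_at_left_filter (cont (delta x)).
  apply: (cvgr_to_le cl).
  by near=> b; apply: (minP b).1.
- have cr := cvg_at_right_filter (cont (delta x)).
  apply: (cvgr_to_ge cr).
  by near=> b; apply: (minP b).2.
Unshelve. all: by end_near. Qed.

Lemma quantile_exclusive (tau tau' : R) (L L' : R -> R -> R) :
  tau <> tau' ->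
  asym_level_class Q tau L -> asym_level_class Q tau' L' ->
  ~ exists delta, bayes_optimal Q L delta /\ bayes_optimal Q L' delta.
Proof.
move=> neq Ltau L'tau' [delta [opt opt']]; apply: neq.
have H := bayes_optimal_cdf Ltau opt.
have H' := bayes_optimal_cdf L'tau' opt'.
(* A probability has a proper almost-everywhere filter, so both identities hold at some common
   [x]. *)
have PF : ProperFilter (almost_everywhere (marginal Q)).
  apply: ae_properfilter_algebraOfSetsType.
  by apply: lt_le_trans lte01 _; rewrite -(probability_setT (marginal Q)).
by have [x [<- <-]] := filter_ex (filterI H H').
Qed.
End PosteriorQuantile.

(** * Margin losses *)

(** The conditional risk [g] has derivative [e * phi' u - (1 - e) * phi' (- u)], which vanishes at
    the global minimum [t]; dividing by [phi' t] and [1 - e] gives the odds. *)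
Lemma margin_minimizer_foc (R : realType) (phi : R -> R) (e t : R) :
  0 < e < 1 -> regular_margin phi ->
  (forall u, e * phi t + (1 - e) * phi (- t) <= e * phi u + (1 - e) * phi (- u)) ->
  margin_invariant phi t = e / (1 - e).
Proof.
move=> /andP[e0 e1] [_ _ [dphi _] _ [phi'0 _ _ _]] tmin.
pose g (u : R) := e * phi u + (1 - e) * phi (- u).
have dg (u : R) : is_derive u 1 g (e * derive1 phi u - (1 - e) * derive1 phi (- u)).
  have := dphi u; have := dphi (- u) => /derivableP d1 /derivableP d2.
  have d3 : is_derive u (1 : R) (phi \o -%R) (- derive1 phi (- u)).
    by rewrite -mulrN1; apply: is_derive1_comp; rewrite derive1E; exact: d1.
  rewrite derive1E.
  have d4 : is_derive u (1 : R) g (e *: 'D_1 phi u + (1 - e) *: (- derive1 phi (- u))).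
    exact: (@is_deriveD _ _ _ (e \*: phi) ((1 - e) \*: (phi \o -%R))).
  by apply: (is_derive_eq d4); rewrite /GRing.scale/= mulrN.
have d0 : is_derive t 1 g 0.
  apply: (@derive1_at_min _ g (t - 1) (t + 1)).
  - lra.
  - by move=> u _; case: (dg u).
  - rewrite in_itv/=; lra.
  - by move=> u _; exact: tmin.
have H := @derive_val _ _ _ _ _ _ _ (dg t).
rewrite (@derive_val _ _ _ _ _ _ _ d0) in H.
rewrite /margin_invariant.
have h := phi'0 t.
have e10 : 1 - e != 0 by rewrite subr_eq0 eq_sym lt_eqF.
apply/eqP; rewrite eqr_div//; apply/eqP; lra.
Qed.

(** The map [u / (1 + u)] inverts the odds [e / (1 - e)], so an interval of odds becomes an interval
    of probabilities within [0, 1], as full support of [eta] requires. *)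
Lemma odds_inv_bounds (R : realFieldType) (u v : R) : 0 < u -> u < v ->
  [/\ 0 <= u / (1 + u), u / (1 + u) < v / (1 + v) & v / (1 + v) <= 1].
Proof.
move=> u0 uv; have v0 : 0 < v by exact: lt_trans uv.
split.
- by rewrite divr_ge0//; lra.
- rewrite ltr_pdivrMr; last lra.
  rewrite mulrAC ltr_pdivlMr; last lra.
  nra.
- by rewrite ler_pdivrMr; lra.
Qed.

Lemma odds_gt (R : realFieldType) (u e : R) : 0 < u -> e < 1 ->
  (u < e / (1 - e)) = (u / (1 + u) < e).
Proof.
move=> u0 e1; rewrite ltr_pdivlMr ?ltr_pdivrMr; [|lra|lra].
by apply/idP/idP; lra.
Qed.

Lemma odds_lt (R : realFieldType) (u e : R) : 0 < u -> e < 1 ->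
  (e / (1 - e) < u) = (e < u / (1 + u)).
Proof.
move=> u0 e1; rewrite ltr_pdivlMr ?ltr_pdivrMr; [|lra|lra].
by apply/idP/idP; lra.
Qed.

Lemma margin_invariant_gt0 (R : realType) (phi : R -> R) (t : R) :
  regular_margin phi -> 0 < margin_invariant phi t.
Proof.
move=> [_ _ _ _ [_ _ _ rg]].
have : range (margin_invariant phi) (margin_invariant phi t) by exists t.
by rewrite rg /= in_itv/= andbT.
Qed.

Lemma margin_separation (R : realType) (d d' : measure_display)
    (Omega : measurableType d) (X : measurableType d')
    (S : margin_setting R Omega X) (phi phi' : R -> R) (f : X -> R) (t : R) :
  regular_margin phi -> regular_margin phi' ->
  margin_bayes_optimal S (margin_loss phi) f ->
  margin_bayes_optimal S (margin_loss phi') f ->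
  ~ margin_invariant phi t < margin_invariant phi' t.
Proof.
move=> rphi rphi' [_ opt] [_ opt'] lt_inv.
have u0 := margin_invariant_gt0 t rphi.
have u'0 := margin_invariant_gt0 t rphi'.
have [a0 ab b1] := odds_inv_bounds u0 lt_inv.
have := eta_full_support S a0 ab b1; rewrite lt_neqAle => /andP[/eqP + _]; apply.
apply/esym/negligibleP.
  by rewrite -[_ @^-1` _]setTI; apply: eta_measurable.
set I := `]_, _[%classic; rewrite -[_ @^-1` I]setCK.
(* [I] consists of the probabilities whose odds lie strictly between the two invariants at [t]; full
   support gives it positive mass, so it is enough that [eta] almost surely avoids it. *)
suff : {ae distribution (margin_pr S) (margin_X S), forall x, ~ I (eta S x)} by [].
have := eta_01 S; apply: filterS3 opt opt' => x xopt xopt' eta01.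
have foc : margin_invariant phi (f x) = eta S x / (1 - eta S x).
  apply: margin_minimizer_foc => // v; move: (xopt v).
  by rewrite /margin_loss !mul1r !mulN1r.
have foc' : margin_invariant phi' (f x) = eta S x / (1 - eta S x).
  apply: margin_minimizer_foc => // v; move: (xopt' v).
  by rewrite /margin_loss !mul1r !mulN1r.
move/andP: eta01 => [e0 e1]; rewrite /I/= in_itv/= -odds_gt// -odds_lt//.
rewrite -{1}foc -foc' => /andP[lt1 lt2].
have [_ _ _ _ [_ _ inc _]] := rphi.
have [_ _ _ _ [_ _ inc' _]] := rphi'.
(* [f x > t] contradicts the bound [lt2] on [phi'], and [f x <= t] contradicts the bound [lt1] on
   [phi]. *)
have [/inc'/lt_trans/(_ lt2)|] := ltP t (f x); first by rewrite ltxx.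
rewrite le_eqVlt => /orP[/eqP E|/inc/lt_trans/(_ lt1)]; last by rewrite ltxx.
by move: lt1; rewrite E ltxx.
Qed.

Lemma margin_exclusive (R : realType) (d d' : measure_display) (Omega : measurableType d)
    (X : measurableType d') (S : margin_setting R Omega X) (phi phi' : R -> R) :
  regular_margin phi -> regular_margin phi' ->
  margin_invariant phi <> margin_invariant phi' ->
  ~ exists f, margin_bayes_optimal S (margin_loss phi) f /\
              margin_bayes_optimal S (margin_loss phi') f.
Proof.
move=> rphi rphi' neq [f [fopt fopt']]; apply: neq; apply/funext => t; apply/eqP.
rewrite eq_le !leNgt; apply/andP; split; apply/negP.
- exact: margin_separation fopt' fopt.
- exact: margin_separation fopt fopt'.
Qed.

(** * Huber losses *)

Section HuberPointwise.
Variable R : realType.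
Implicit Types k s t u v : R.

(** Splitting into the three affine pieces reduces the estimates below to arithmetic. *)
Lemma huber_psiP k u : 0 < k ->
  [\/ u < - k /\ huber_psi k u = - k, - k <= u <= k /\ huber_psi k u = u
    | k < u /\ huber_psi k u = k].
Proof.
move=> k0; rewrite /huber_psi; case: (lerP `|u| k) => [|].
  by rewrite ler_norml; constructor 2.
rewrite ltr_normr => /orP[ku|ku].
- by constructor 3; rewrite gtr0_sg ?mulr1//; exact: lt_trans ku.
- by constructor 1; rewrite ltr0_sg ?mulrN1; [split=> //; lra|lra].
Qed.

Lemma huber_psiE k u : 0 < k -> huber_psi k u = Num.max (- k) (Num.min u k).
Proof.
move=> k0; case: (huber_psiP u k0) => -[ku ->].
- by rewrite min_l ?max_l//; lra.
- by rewrite min_l ?max_r//; lra.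
- by rewrite min_r ?max_r//; lra.
Qed.

Lemma huber_psiN k u : huber_psi k (- u) = - huber_psi k u.
Proof. by rewrite /huber_psi normrN sgrN mulrN; case: ifP. Qed.

Lemma huber_psi_bound k u : 0 < k -> `|huber_psi k u| <= k.
Proof.
by move=> k0; rewrite ler_norml; case: (huber_psiP u k0) => -[ku ->]; lra.
Qed.

Lemma huber_psi_lipschitz k u v : 0 < k ->
  `|huber_psi k u - huber_psi k v| <= `|u - v|.
Proof.
move=> k0; have := ler_norm (u - v); have := ler_norm (- (u - v)).
rewrite normrN => ? ?; rewrite ler_norml.
by case: (huber_psiP u k0) => -[? ->]; case: (huber_psiP v k0) => -[? ->]; lra.
Qed.

Lemma huber_psi_threshold_lipschitz s t u : 0 < s -> 0 < t ->
  `|huber_psi s u - huber_psi t u| <= `|s - t|.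
Proof.
move=> s0 t0; have := ler_norm (s - t); have := ler_norm (- (s - t)).
rewrite normrN => ? ?; rewrite ler_norml.
by case: (huber_psiP u s0) => -[? ->]; case: (huber_psiP u t0) => -[? ->]; lra.
Qed.

(** Raising the threshold from [s] to [t] adds exactly [t - s] above [t], loses at most [t - s]
    below [- s], and does not lower the score in between. *)
Lemma huber_psi_threshold_incr s t u : 0 < s -> s <= t ->
  huber_psi s u + (t - s) * ((t < u)%R%:R - (u < - s)%R%:R) <= huber_psi t u.
Proof.
move=> s0 st; have t0 : 0 < t by exact: lt_le_trans st.
by case: (ltP t u) => ?; case: (ltP u (- s)) => ?; case: (huber_psiP u s0) => -[? ->];
  case: (huber_psiP u t0) => -[? ->]; rewrite /=; lra.
Qed.

(** This is the dual form of the loss: the maximum of [p * u - p ^+ 2 / 2] over [p] in [[- k, k]],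
    attained at [p = huber_psi k u]. *)
Lemma huber_lossE k t a : 0 < k ->
  huber_loss k t a = huber_psi k (a - t) * (a - t) - huber_psi k (a - t) ^+ 2 / 2.
Proof.
move=> k0; rewrite /huber_loss /huber_psi; case: ifPn => [_|].
  by field.
rewrite -ltNge => ku; have u0 : a - t != 0.
  by rewrite -normr_gt0; exact: lt_trans ku.
by rewrite exprMn sqr_sg u0 mulr1 -mulrA -normrEsg.
Qed.

(** With [q = huber_psi k u] and [p = huber_psi k v], the gap between the two sides is
    [(q - p) * (u - q) + (q - p) ^+ 2 / 2], and both terms are nonnegative. *)
Lemma huber_loss_ge_tangent k t a b : 0 < k ->
  huber_loss k t b + huber_psi k (b - t) * (a - b) <= huber_loss k t a.
Proof.
move=> k0; rewrite !huber_lossE//.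
have -> : a - b = (a - t) - (b - t) by ring.
move: (a - t) (b - t) => u v.
have := huber_psi_bound v k0; rewrite ler_norml; set p := huber_psi k v => pk.
(* [huber_psi k u] is the projection of [u] on [[- k, k]]. *)
have proj : 0 <= (huber_psi k u - p) * (u - huber_psi k u).
  case: (huber_psiP u k0) => -[uk ->].
  - by rewrite mulr_le0//; lra.
  - by rewrite subrr mulr0.
  - by rewrite mulr_ge0//; lra.
have := sqr_ge0 (huber_psi k u - p); move: proj; lra.
Qed.

End HuberPointwise.

(* Between two zeros crossed upwards, the last point where [G >= 0] would be
   followed by points where [G >= 0]. *)
Lemma no_two_up_crossings (R : realType) (G : R -> R) (a b : R) :
  0 < a -> a < b -> {in `]0, +oo[, continuous G} ->
  (forall t, 0 < t -> G t = 0 ->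
    (\forall u \near t^'+, 0 < G u) /\ (\forall u \near t^'-, G u < 0)) ->
  G a = 0 -> G b <> 0.
Proof.
move=> a0 ab Gcont cross Ga Gb.
pose E := [set t | a <= t < b /\ 0 <= G t].
have Ea : E a by split; [rewrite lexx ab|rewrite Ga].
have ubE : ubound E b by move=> t [/andP[_ /ltW]].
have supE : has_sup E by split; [exists a|exists b].
set c := sup E.
have ac : a <= c by apply: ub_le_sup Ea; exists b.
have c0 : 0 < c by exact: lt_le_trans ac.
have cb : c < b.
  have [_ Gneg] := cross b (lt_trans a0 ab) Gb.
  (* [G] is negative just to the left of [b], so [E] stays away from [b]. *)
  have : \forall u \near b^'-, ubound E u.
    have [e /= e0 He] := Gneg.
    near=> u => t [/andP[_ tb] Gt].
    rewrite leNgt; apply/negP => ut.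
    suff : G t < 0 by rewrite ltNge Gt.
    apply: He => //=; rewrite ltr_distl; have : b - e < u.
      by near: u; apply: nbhs_left_gt; rewrite ltrBlDr ltrDl.
    lra.
  move=> ubu.
  have : \forall u \near b^'-, c < b.
    near=> u.
    apply: (@le_lt_trans _ _ u) => //.
    by apply: ge_sup; [exists a|near: u].
  by move=> /filter_ex[].
have Gcc : G u @[u --> c] --> G c by apply: Gcont; rewrite in_itv/= c0.
have Gc0 : 0 <= G c.
  rewrite leNgt; apply/negP => Gc.
  have [e /= e0 He] := cvgr_lt _ Gcc _ Gc.
  have [t Et ct] := sup_adherent e0 supE.
  have tc : t <= c by apply: ub_le_sup Et; exists b.
  suff : G t < 0 by rewrite ltNge Et.2.
  by apply: He => /=; rewrite ger0_norm ?subr_ge0//; rewrite -/c in ct; lra.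
(* If [G c = 0], the upward crossing gives this; if [G c > 0], continuity does. Points just right of
   [c] then belong to [E], beyond its supremum. *)
have right_pos : \forall u \near c^'+, 0 <= G u.
  have [Gc|Gc] := eqVneq (G c) 0.
    by have [+ _] := cross c c0 Gc; apply: filterS => u /ltW.
  have {Gc0}Gc0 : 0 < G c by rewrite lt_def Gc.
  exact: cvgr_ge _ (cvg_at_right_filter Gcc) _ Gc0.
have : \forall u \near c^'+, False.
  near=> u.
  have cu : c < u by [].
  have : u <= c.
    apply: ub_le_sup; first by exists b.
    split; last by near: u.
    by apply/andP; split; [exact: (le_trans ac (ltW cu))|].
  by rewrite leNgt cu.
by move=> /filter_ex[].
Unshelve. all: by end_near. Qed.

(** * The mean Huber score as a function of the threshold *)

Section HuberRoot.
Variables (R : realType) (d : measure_display) (Omega : measurableType d).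
Variable P : probability Omega R.
Implicit Types (k s t b : R) (U V : {RV P >-> R}).

Definition mean_psi U k : R := \int[P]_w huber_psi k (U w).

Lemma measurable_huber_psi U k : 0 < k ->
  measurable_fun setT (fun w => huber_psi k (U w)).
Proof.
move=> k0; under eq_fun do rewrite huber_psiE//.
by apply: measurable_maxr => //; exact: measurable_minr.
Qed.

Lemma integrable_huber_psi U k : 0 < k ->
  P.-integrable setT (EFin \o (fun w => huber_psi k (U w))).
Proof.
move=> k0; apply: measurable_bounded_integrable => //.
- exact: le_lt_trans (probability_le1 P measurableT) (ltry 1).
- exact: measurable_huber_psi.
- exists k; split; first exact: num_real.
  by move=> M kM w _; exact: le_trans (huber_psi_bound _ k0) (ltW kM).
Qed.

(** The loss grows linearly: it is dominated by [k * |U|]. *)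
Lemma integrable_huber_loss U k : 0 < k ->
  P.-integrable setT (EFin \o U) ->
  P.-integrable setT (EFin \o (fun w => huber_loss k 0 (U w))).
Proof.
move=> k0 iU.
have mpsi := measurable_huber_psi U k0.
apply: (@le_integrable _ _ _ P _ measurableT _ (EFin \o (fun w => k * U w))).
- apply/measurable_EFinP; under eq_fun do rewrite huber_lossE// subr0.
  apply: measurable_funB; first exact: measurable_funM.
  by apply: measurable_funM => //; exact: measurable_funX.
- move=> w _ /=; rewrite lee_fin normrM (gtr0_norm k0) huber_lossE// subr0.
  move: (U w) => u; case: (huber_psiP u k0) => -[ku ->].
  + have uE : `|u| = - u by apply: ltr0_norm; lra.
    have : 0 <= k * (- k - u) by rewrite mulr_ge0 ?ltW//; lra.
    by have := sqr_ge0 k; move=> ? ?; rewrite uE ger0_norm; lra.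
  + have -> : u * u - u ^+ 2 / 2 = `|u| ^+ 2 / 2 by rewrite real_normK ?num_real//; field.
    have uk : `|u| <= k by rewrite ler_norml.
    have : 0 <= `|u| * (k - `|u|) by rewrite mulr_ge0// subr_ge0.
    by have := sqr_ge0 `|u|; move=> ? ?; rewrite [X in X <= _]ger0_norm; lra.
  + have uE : `|u| = u by apply: gtr0_norm; lra.
    have : 0 <= k * (u - k) by rewrite mulr_ge0 ?ltW//; lra.
    by have := sqr_ge0 k; move=> ? ?; rewrite uE ger0_norm; lra.
- exact: (integrableZl measurableT k iU).
Qed.

Lemma mean_psi_lipschitz U s t : 0 < s -> 0 < t ->
  `|mean_psi U s - mean_psi U t| <= `|s - t|.
Proof.
move=> s0 t0.
rewrite /mean_psi -RintegralB//; [|exact: integrable_huber_psi..].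
have iB : P.-integrable setT
    (EFin \o (fun w => huber_psi s (U w) - huber_psi t (U w))).
  exact: (integrableB measurableT
    (integrable_huber_psi U s0) (integrable_huber_psi U t0)).
apply: le_trans (le_normr_Rintegral _ iB) _ => //.
apply: (@le_trans _ _ (\int[P]_w `|s - t|)).
  apply: le_Rintegral => //.
  - exact: integrable_norm iB.
  - exact: finite_measure_integrable_cst.
  - by move=> w _; exact: huber_psi_threshold_lipschitz.
by rewrite Rintegral_cst// [X in fine X](probability_setT P) mulr1.
Qed.

Lemma mean_psi_shift_lipschitz U k h : 0 < k ->
  `|mean_psi U k - mean_psi (U \- cst h)%R k| <= `|h|.
Proof.
move=> k0.
have iU := integrable_huber_psi U k0.
have iV := integrable_huber_psi (U \- cst h)%R k0.
rewrite /mean_psi -RintegralB//.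
have iB : P.-integrable setT
    (EFin \o (fun w => huber_psi k (U w) - huber_psi k (U w - h))).
  exact: (integrableB measurableT iU iV).
apply: le_trans (le_normr_Rintegral _ iB) _ => //.
apply: (@le_trans _ _ (\int[P]_w `|h|)).
  apply: le_Rintegral => //.
  - exact: integrable_norm iB.
  - exact: finite_measure_integrable_cst.
  - move=> w _; apply: le_trans (huber_psi_lipschitz _ _ k0) _.
    by rewrite opprB addrC subrK.
by rewrite Rintegral_cst// [X in fine X](probability_setT P) mulr1.
Qed.

Lemma measurable_gt U t : measurable [set w | t < U w].
Proof.
rewrite (_ : [set _ | _] = U @^-1` `]t, +oo[%classic).
  exact: measurable_funPTI.
by apply/seteqP; split=> w; rewrite /= in_itv/= andbT.
Qed.

Lemma measurable_lt U t : measurable [set w | U w < t].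
Proof.
rewrite (_ : [set _ | _] = U @^-1` `]-oo, t[%classic).
  exact: measurable_funPTI.
by apply/seteqP; split=> w; rewrite /= in_itv.
Qed.

Lemma Rintegral_indic (A : set Omega) : measurable A ->
  \int[P]_w (\1_A w : R) = fine (P A).
Proof. by move=> mA; rewrite /Rintegral integral_indic// setIT. Qed.

(** This difference bound replaces the derivative in the threshold. Fixing [s] or [t] gives the
    growth to the right or to the left of a point. *)
Lemma mean_psi_incr U s t : 0 < s -> s <= t ->
  mean_psi U s + (t - s) * (fine (P [set w | t < U w]) - fine (P [set w | U w < - s]))
    <= mean_psi U t.
Proof.
move=> s0 st; have t0 : 0 < t by exact: lt_le_trans st.
set A := [set w | t < U w]; set B := [set w | U w < - s].
have mA : measurable A by exact: measurable_gt.
have mB : measurable B by exact: measurable_lt.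
have iA := integrable_indic P mA.
have iB := integrable_indic P mB.
have iAB := integrableB measurableT iA iB.
have iC := integrableZl measurableT (t - s) iAB.
have iS := integrable_huber_psi U s0.
rewrite -!Rintegral_indic// -RintegralB// -RintegralZl// -RintegralD//.
apply: le_Rintegral => //.
- exact: (integrableD measurableT iS iC).
- exact: integrable_huber_psi.
- move=> w _; rewrite !indicE !mem_setE.
  exact: huber_psi_threshold_incr.
Qed.

Lemma mean_psi_continuous U : {in `]0, +oo[, continuous (mean_psi U)}.
Proof.
move=> t; rewrite in_itv/= andbT => t0; apply/cvgrPdist_le => e e0.
near=> s.
apply: le_trans (mean_psi_lipschitz _ t0 _) _.
  by near: s; exact: lt_nbhsr.
by near: s; exact: cvgr_dist_le.
Unshelve. all: by end_near. Qed.

Lemma mean_psi_crossing U t : (forall c, P (U @^-1` [set c]) = 0%E) -> 0 < t ->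
  fine (P [set w | U w < - t]) < fine (P [set w | t < U w]) ->
  (\forall u \near t^'+, mean_psi U t < mean_psi U u) /\
  (\forall u \near t^'-, mean_psi U u < mean_psi U t).
Proof.
move=> atomless t0 lt_tail.
set p := fun s => fine (P [set w | s < U w]).
set q := fun s => fine (P [set w | U w < - s]).
have cvg_p : p s @[s --> t^'+] --> p t.
  have pE s : p s = fine (ccdf U s).
    rewrite /p /ccdf /distribution/= /pushforward; congr (fine (P _)).
    by apply/seteqP; split=> w; rewrite /= in_itv/= andbT.
  rewrite pE; under eq_fun do rewrite pE.
  apply: fine_cvg; rewrite fineK ?fin_num_measure//.
  exact: ccdf_right_continuous.
(* As [s] increases to [t], [- s] decreases to [- t], where the cdf is right continuous;
   atomlessness identifies its value there with the strict tail [q t]. *)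
have cvg_q : fine (cdf U (- s)) @[s --> t^'-] --> q t.
  have -> : q t = fine (cdf U (- t)).
    rewrite /q /cdf /distribution/= /pushforward; congr fine.
    rewrite (_ : U @^-1` _ = [set w | U w < - t] `|` U @^-1` [set - t]).
      by rewrite measureU0//; [exact: measurable_lt|exact: atomless].
    apply/seteqP; split=> w; rewrite /= in_itv/= le_eqVlt.
      by move=> /orP[/eqP|]; [right|left].
    by move=> [->|->]; rewrite ?orbT ?eqxx.
  apply/cvg_at_leftNP; rewrite /comp; under eq_fun do rewrite opprK.
  apply: fine_cvg; rewrite fineK ?fin_num_measure//.
  exact: cdf_right_continuous.
have q_le s : q s <= fine (cdf U (- s)).
  rewrite fine_le ?fin_num_measure//; first exact: measurable_lt.
  rewrite /cdf /distribution/= /pushforward le_measure ?inE//.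
  - exact: measurable_lt.
  - exact: measurable_funPTI.
  - by move=> w; rewrite /= in_itv/= => /ltW.
split.
- near=> u.
  have tu : t < u by [].
  have pq : q t < p u by near: u; exact: cvgr_gt cvg_p _ lt_tail.
  apply: lt_le_trans (mean_psi_incr U t0 (ltW tu)).
  by rewrite ltrDl mulr_gt0 ?subr_gt0.
- near=> u.
  have ut : u < t by [].
  have u0 : 0 < u by near: u; exact: nbhs_left_gt.
  have qp : fine (cdf U (- u)) < p t by near: u; exact: cvgr_lt cvg_q _ lt_tail.
  apply: lt_le_trans (mean_psi_incr U u0 (ltW ut)).
  by rewrite ltrDl mulr_gt0 ?subr_gt0//; exact: le_lt_trans (q_le u) qp.
Unshelve. all: by end_near. Qed.

Lemma mean_psi_root_unique U k k' :
  (forall c, P (U @^-1` [set c]) = 0%E) ->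
  (forall t, 0 < t -> mean_psi U t = 0 ->
    fine (P [set w | U w < - t]) < fine (P [set w | t < U w])) ->
  0 < k -> 0 < k' -> mean_psi U k = 0 -> mean_psi U k' = 0 -> k = k'.
Proof.
move=> atomless skew.
have uniq_lt t t' : 0 < t -> t < t' -> mean_psi U t = 0 -> mean_psi U t' <> 0.
  move=> t0 tt'; apply: no_two_up_crossings => //; first exact: mean_psi_continuous.
  move=> u u0 Gu; have := mean_psi_crossing atomless u0 (skew _ u0 Gu).
  by rewrite Gu.
move=> k0 k'0 Gk Gk'.
have [kk'|k'k|//] := ltgtP k k'.
- by case: (uniq_lt _ _ k0 kk' Gk Gk').
- by case: (uniq_lt _ _ k'0 k'k Gk' Gk).
Qed.

Lemma mean_psiN U k : 0 < k -> mean_psi (\- U)%R k = - mean_psi U k.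
Proof.
move=> k0; rewrite /mean_psi -mulN1r -RintegralZl//; last exact: integrable_huber_psi.
by apply: eq_Rintegral => w _; rewrite mulN1r -huber_psiN.
Qed.

(** The tangent inequality at [U - h], integrated and combined with minimality, makes [h] times the
    mean score of [U - h] nonpositive. Letting [h] tend to 0 from either side, with the Lipschitz
    bound in the shift, leaves only the value 0. *)
Lemma mean_psi_minimizer U k : 0 < k -> P.-integrable setT (EFin \o U) ->
  (forall h, \int[P]_w huber_loss k 0 (U w) <= \int[P]_w huber_loss k 0 (U w - h)) ->
  mean_psi U k = 0.
Proof.
move=> k0 iU Umin.
have slope h : h * mean_psi (U \- cst h)%R k <= 0.
  have iV : P.-integrable setT (EFin \o (U \- cst h)%R).
    exact: (integrableB measurableT iU (finite_measure_integrable_cst P h measurableT)).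
  have iLU := integrable_huber_loss k0 iU.
  have iLV := integrable_huber_loss k0 iV.
  have iZ := integrableZl measurableT h (integrable_huber_psi (U \- cst h)%R k0).
  rewrite -(lerD2l (\int[P]_w huber_loss k 0 ((U \- cst h)%R w))) addr0.
  apply: le_trans (Umin h).
  rewrite -RintegralZl//; last exact: integrable_huber_psi.
  rewrite -RintegralD//; apply: le_Rintegral => //.
    exact: (integrableD measurableT iLV iZ).
  move=> w _ /=; have := huber_loss_ge_tangent 0 (U w) (U w - h) k0.
  by rewrite subr0 subKr mulrC.
apply/eqP; rewrite eq_le; apply/andP; split; apply/ler_addgt0Pl => e e0.
- have := mean_psi_shift_lipschitz U e k0.
  rewrite (gtr0_norm e0) ler_norml lerBlDr => /andP[_ /le_trans]; apply.
  by rewrite lerD2l -(pmulr_rle0 _ e0).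
- have := mean_psi_shift_lipschitz U (- e) k0.
  rewrite normrN (gtr0_norm e0) ler_norml lerBrDr -lerBlDl sub0r => /andP[+ _].
  apply: le_trans; rewrite lerDl -(nmulr_rle0 _ (_ : - e < 0)) ?oppr_lt0//.
Qed.

End HuberRoot.

(** * Equivariant rules and the common Huber root *)

Section HuberExclusivity.
Variables (R : realType) (d : measure_display) (Omega : measurableType d).
Variable S : huber_setting R Omega.
Implicit Types k b : R.

Local Notation P := (huber_pr S).
Local Notation Z := (huber_Z S).

Definition residual b : {RV P >-> R} := (Z \- cst b)%R.

Lemma huber_Z_integrableT : P.-integrable setT (EFin \o Z).
Proof.
apply/integrableP; split; first exact/measurable_EFinP.
by have := huber_Z_integrable S; rewrite unlock.
Qed.

Lemma huber_Z_shift_integrable b : P.-integrable setT (EFin \o residual b).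
Proof.
exact: (integrableB measurableT huber_Z_integrableT
  (finite_measure_integrable_cst P b measurableT)).
Qed.

Lemma huber_Z_atomless c : P (Z @^-1` [set c]) = 0%E.
Proof.
have := huber_densityE S (measurable_set1 c).
by rewrite integral_set1.
Qed.

Lemma equivariant_riskE k b : 0 < k ->
  equivariant_risk S (huber_loss k) 0 b =
  (\int[P]_w huber_loss k 0 (Z w - b))%:E.
Proof.
move=> k0; rewrite /equivariant_risk unlock /Rintegral fineK.
  by apply: eq_integral => w _; rewrite /equivariant_rule add0r.
exact: (integrable_fin_num measurableT
  (integrable_huber_loss k0 (huber_Z_shift_integrable b))).
Qed.

Lemma mean_psi_huber_b k b : 0 < k ->
  mean_psi (residual b) k = 0 <-> b = huber_b S k.
Proof.
move=> k0; rewrite -(huber_bP S k0 b) unlock /mean_psi /Rintegral.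
(* [fine] also sends infinite values to 0, so finiteness is what turns a zero real integral into a
   zero expectation. *)
have fin := integrable_fin_num measurableT (integrable_huber_psi (residual b) k0).
by split=> [H|->//]; rewrite -[LHS](fineK fin) H.
Qed.

Lemma equivariant_optimal_huber_b k b : 0 < k ->
  equivariant_optimal S (huber_loss k) (equivariant_rule b) -> b = huber_b S k.
Proof.
(* Evaluation at 0 recovers the shift from the rule. *)
move=> k0 [b' /(congr1 (fun f => f 0)) + opt]; rewrite /equivariant_rule !sub0r.
move=> /oppr_inj ->; apply/mean_psi_huber_b => //.
apply: mean_psi_minimizer => // [|h]; first exact: huber_Z_shift_integrable.
(* Optimality at [theta = 0] against the shift [b' + h] compares the residual with its translate by
   [h]. *)
have := opt 0 (b' + h); rewrite !equivariant_riskE// lee_fin.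
by under [in X in _ <= X -> _]eq_Rintegral do rewrite opprD addrA.
Qed.

Lemma huber_b_inj k k' : 0 < k -> 0 < k' -> huber_b S k = huber_b S k' -> k = k'.
Proof.
move=> k0 k'0 bb'; set b := huber_b S k in bb'.
have root : mean_psi (residual b) k = 0 by apply/mean_psi_huber_b.
have root' : mean_psi (residual b) k' = 0 by apply/mean_psi_huber_b.
have atomless c : P (residual b @^-1` [set c]) = 0%E.
  rewrite -(huber_Z_atomless (c + b)); congr (P _).
  by apply/seteqP; split=> w /=; [move=> <-; rewrite subrK|move=> ->; rewrite addrK].
have [sigma [sigmaE skew]] := huber_skewed S.
case: sigmaE skew => -> skew.
- apply: (mean_psi_root_unique atomless) => // t t0 /(mean_psi_huber_b _ t0) bt.
  by have := skew t t0; rewrite mul1r subr_gt0 -bt.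
(* For [sigma = -1], negating the residual exchanges its tails and keeps the zeros of the mean
   score, so crossings are again upward. *)
- apply: (@mean_psi_root_unique _ _ _ P (\- (Z \- cst b))%R) => //.
  + move=> c; rewrite -(atomless (- c)); congr (P _).
    by apply/seteqP; split=> w /=; [move=> <-; rewrite opprK|move=> ->; rewrite opprK].
  + move=> t t0; rewrite mean_psiN// => /eqP; rewrite oppr_eq0 => /eqP.
    move=> /(mean_psi_huber_b _ t0) bt.
    have := skew t t0; rewrite mulN1r opprB subr_gt0 -bt.
    congr (fine (P _) < fine (P _)).
      by apply/seteqP; split=> w /=; rewrite ltrN2.
    by apply/seteqP; split=> w /=; rewrite ltrNr.
  + by rewrite mean_psiN// root oppr0.
  + by rewrite mean_psiN// root' oppr0.
Qed.

Lemma huber_exclusive k k' : 0 < k -> 0 < k' -> k <> k' ->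
  ~ exists delta, equivariant_optimal S (huber_loss k) delta /\
                  equivariant_optimal S (huber_loss k') delta.
Proof.
move=> k0 k'0 kk' [delta [opt opt']]; apply: kk'; have [b deltaE _] := opt.
rewrite {}deltaE in opt opt'.
apply: huber_b_inj => //.
by rewrite -(equivariant_optimal_huber_b k0 opt) -(equivariant_optimal_huber_b k'0 opt').
Qed.

End HuberExclusivity.

Theorem corollary1 (R : realType) :
  [/\ (forall (T Loss I : Type) (D : set T) (O : Loss -> set T)
         (M : set Loss) (C : I -> set Loss) (i j : I) (L L' : Loss),
         optimality_operator D O -> exclusivity_partition D O M C ->
         realizable O C -> i <> j -> C i L -> C j L' ->
         O L `&` O L' = set0),
      (forall (d : measure_display) (X : measurableType d)
         (Q : quantile_setting R X) (tau tau' : R) (L L' : R -> R -> R),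
         0 < tau < 1 -> 0 < tau' < 1 -> tau <> tau' ->
         asym_level_class Q tau L -> asym_level_class Q tau' L' ->
         ~ exists delta, bayes_optimal Q L delta /\ bayes_optimal Q L' delta),
      (forall (d d' : measure_display) (Omega : measurableType d)
         (X : measurableType d') (S : margin_setting R Omega X)
         (phi phi' : R -> R),
         regular_margin phi -> regular_margin phi' ->
         margin_invariant phi <> margin_invariant phi' ->
         ~ exists f, margin_bayes_optimal S (margin_loss phi) f /\
                     margin_bayes_optimal S (margin_loss phi') f)
    & (forall (d : measure_display) (Omega : measurableType d)
         (S : huber_setting R Omega) (kappa kappa' : R),
         0 < kappa -> 0 < kappa' -> kappa <> kappa' ->
         ~ exists delta, equivariant_optimal S (huber_loss kappa) delta /\
                         equivariant_optimal S (huber_loss kappa') delta)].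
Proof.
split.
- move=> T Loss I D O M C i j L L' OD exclC _.
  exact: optimal_disjoint exclC.
- by move=> d X Q tau tau' L L' _ _; exact: quantile_exclusive.
- by move=> d d' Omega X S phi phi'; exact: margin_exclusive.
- by move=> d Omega S kappa kappa'; exact: huber_exclusive.
Qed.
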